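(* For every integer $\omega$ there exists a CSP instance $\mathbf{I}_{\omega}$ with hypergraph $H^\omega$ such that $\mathsf{jw}(\mathbf{I}_\omega)\leq 2$ and $\mathsf{fec}(H^\omega)\leq 2$ (and hence also $\mathsf{fhtw}(H^\omega)\leq 2$), but $\mathsf{jw}_{proj}(\mathbf{I}_\omega)\geq \omega$.
   Context: CSP. A CSP instance $\mathbf{I}=\langle V,D,C\rangle$ consists of a finite set $V$ of variables, a finite domain $D$ and a set $C$ of constraints. A constraint $c$ has a scope $S(c)$ (a totally ordered subset of $V$) and a relation $R(c)\subseteq D^{|S(c)|}$; $|c|$ is the number of tuples in $R(c)$. It is assumed that every variable occurs in the scope of at least one constraint. For $t\in R(c)$ and $v\in S(c)$, $t[v]$ is the entry of $t$ at the position of $v$; $t[V']$ is the restriction of $t$ to the variables in $S(c)\cap V'$. $\sharp_{\mathrm{tup}}(\mathbf{I})$ is the maximum number of tuples in any constraint relation of $\mathbf{I}$. The join $c\bowtie c'$ is the constraint with scope $S(c)\cup S(c')$ (first $S(c)$, then $S(c')\setminus S(c)$) whose tuples are the combinations of $t\in R(c)$ and $t'\in R(c')$ that agree on $S(c)\cap S(c')$. The projection $\pi_{V'}(c)$ has scope $S(c)\cap V'$ and relation $\{t[V'] : t\in R(c)\}$ (so for $S(c)\cap V'=\emptyset$ it contains just the empty tuple if $R(c)\neq\emptyset$, and no tuple otherwise). The hypergraph of $\mathbf{I}$ has vertex set $V$ and edge set $\{S(c):c\in C\}$. Join decompositions. A join decomposition for $\mathbf{I}$ is a pair $(J,\varrho)$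 where $J$ is a rooted binary tree and $\varrho$ is a bijection between the leaves of $J$ and $C$. For a node $j$ of $J$, let $X(j)$ be the set of constraints $\varrho(\ell)$ over leaves $\ell$ of the subtree rooted at $j$, $V(j)=\bigcup_{c\in X(j)}S(c)$ and $\overline{V}(j)=\bigcup_{c\in C\setminus X(j)}S(c)$. Define $C_{proj}(j)=\pi_{\overline{V}(j)}(\varrho(j))$ if $j$ is a leaf, and $C_{proj}(j)=\pi_{\overline{V}(j)}(C_{proj}(j_1)\bowtie C_{proj}(j_2))$ if $j$ has children $j_1,j_2$. For a constraint $c$, $\mathsf{prune}(c)$ is obtained from $c$ by removing all tuples $t\in R(c)$ for which there is a constraint $c'\in C$ with $t[S(c')]\notin \pi_{S(c)}(c')$. Set $C(j)=\mathsf{prune}(C_{proj}(j))$. The joinwidth $\mathsf{jw}(j)$ of $j$ is the smallest real $\omega$ with $|C(j)|\leq (\sharp_{\mathrm{tup}}(\mathbf{I}))^{\omega}$, i.e. $\log_{\sharp_{\mathrm{tup}}(\mathbf{I})}|C(j)|$. The joinwidth of a join decomposition is the maximum of $\mathsf{jw}(j)$ over its nodes, and $\mathsf{jw}(\mathbf{I})$ is the minimum joinwidth over all join decompositions of $\mathbf{I}$. $\mathsf{jw}_{proj}(\mathbf{I})$ is defined in the same way, with $C_{proj}(j)$ in place of $C(j)$. Covers. For a hypergraph $H$, a fractional edge cover is a mapping $\gamma:E(H)\to\mathbb{R}_{\geq 0}$ with $\sum_{e\in E(H), v\in e}\gamma(e)\geq 1$ for every $v\in V(H)$; its weight is $\sum_{e\in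 E(H)}\gamma(e)$, and $\mathsf{fec}(H)$ is the smallest weight of a fractional edge cover of $H$. A fractional hypertree decomposition of $H$ is a triple $(T,(B_t)_{t\in V(T)},(\gamma_t)_{t\in V(T)})$ where $(T,(B_t)_t)$ is a tree decomposition of $H$ and each $\gamma_t:E(H)\to\mathbb{R}_{\geq0}$ satisfies $\sum_{e\in E(H),v\in e}\gamma_t(e)\ge1$ for every $v\in B_t$; its width is the maximum weight of the $\gamma_t$, and $\mathsf{fhtw}(H)$ is the minimum width of such a decomposition. *)

(* Defs.v *)
From HB Require Import structures.
From mathcomp Require Import all_boot all_order all_algebra finmap.
From mathcomp Require Import all_classical all_reals all_analysis.

Set Implicit Arguments.
Unset Strict Implicit.
Unset Printing Implicit Defensive.

Import Order.TTheory GRing.Theory Num.Theory.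

Local Open Scope ring_scope.

Section Constraints.
Variables V D : finType.

Record constraint := Constraint {
  crep : {s : seq V & {set (size s).-tuple D}};
  scope_uniq : uniq (tag crep)
}.

HB.instance Definition _ := [isSub for crep].
HB.instance Definition _ := [Choice of constraint by <:].

Definition scope (c : constraint) : seq V := tag (crep c).

Definition tuples (c : constraint) : {set (size (scope c)).-tuple D} :=
  tagged (crep c).

Definition mk_constraint (s : seq V) (us : uniq s)
    (r : {set (size s).-tuple D}) : constraint :=
  @Constraint (Tagged (fun s => {set (size s).-tuple D}) r) us.

Definition vars (c : constraint) : {set V} := [set v in scope c].

(* t[W] for a tuple t over the scope s, as a partial assignment of variables:
   it is None outside W and outside s. In this form restrictions of tuples
   over differently ordered scopes can be compared. *)
Definition restr (s : seq V) (t : (size s).-tuple D) (W : {set V}) :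
    {ffun V -> option D} :=
  [ffun v => if v \in W then onth t (index v s) else None].

Definition proj_scope (W : {set V}) (c : constraint) : seq V :=
  [seq v <- scope c | v \in W].

Lemma proj_scope_uniq W c : uniq (proj_scope W c).
Proof. exact/filter_uniq/scope_uniq. Qed.

Definition project (W : {set V}) (c : constraint) : constraint :=
  mk_constraint (proj_scope_uniq W c)
    [set u | [exists t in tuples c, restr u [set: V] == restr t W]].

Definition join_scope (c c' : constraint) : seq V :=
  scope c ++ [seq v <- scope c' | v \notin scope c].

Lemma join_scope_uniq c c' : uniq (join_scope c c').
Proof.
rewrite cat_uniq scope_uniq filter_uniq ?scope_uniq // andbT /=.
by apply/hasPn => v; rewrite mem_filter => /andP[].
Qed.

(* A tuple u restricting to both t and t' exists exactly when t and t' agree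
   on the common variables; it is then their combination. *)
Definition join (c c' : constraint) : constraint :=
  mk_constraint (join_scope_uniq c c')
    [set u | [exists t in tuples c, exists t' in tuples c',
       (restr u (vars c) == restr t (vars c)) &&
       (restr u (vars c') == restr t' (vars c'))]].

Definition prune (C : {fset constraint}) (c : constraint) : constraint :=
  mk_constraint (scope_uniq c)
    [set t in tuples c | all (fun c' =>
       restr t (vars c') \in [set restr t' (vars c) | t' in tuples c']) C].

End Constraints.

Record csp (V D : finType) := CSP {
  cstrs : {fset constraint V D};
  cstrs_cover : forall v : V, exists2 c, c \in cstrs & v \in scope c
}.

Definition tup (V D : finType) (I : csp V D) : nat :=
  \max_(c <- cstrs I) #|tuples c|.

Inductive btree (A : Type) : Type :=
  | Leaf of A
  | Node of btree A & btree A.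
Arguments Leaf {A} _.
Arguments Node {A} _ _.

Fixpoint leaves A (j : btree A) : seq A :=
  match j with
  | Leaf a => [:: a]
  | Node j1 j2 => leaves j1 ++ leaves j2
  end.

Fixpoint subtrees A (j : btree A) : seq (btree A) :=
  j :: match j with
       | Leaf _ => [::]
       | Node j1 j2 => subtrees j1 ++ subtrees j2
       end.

Section Joinwidth.
Variables (V D : finType) (I : csp V D).

(* The bijection between leaves and constraints is carried by the leaf labels;
   a node is identified with the subtree rooted at it. *)
Definition join_decomposition (J : btree (constraint V D)) : Prop :=
  perm_eq (leaves J) (cstrs I).

Definition Vbar (j : btree (constraint V D)) : {set V} :=
  \bigcup_(c <- cstrs I | c \notin leaves j) vars c.

Fixpoint Cproj (j : btree (constraint V D)) : constraint V D :=
  project (Vbar j)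
    match j with
    | Leaf c => c
    | Node j1 j2 => join (Cproj j1) (Cproj j2)
    end.

Definition Cpruned (j : btree (constraint V D)) : constraint V D :=
  prune (cstrs I) (Cproj j).

Variable R : realType.

(* The least exponent, i.e. the logarithm of #|tuples c| in base tup I when
   tuples c is nonempty and tup I > 1. Where no least real exponent exists
   because every exponent works (tuples c empty, or tup I = #|tuples c| = 1),
   the value is -oo. *)
Definition size_exponent (c : constraint V D) : \bar R :=
  ereal_inf [set w%:E | w in
    [set w : R | #|tuples c|%:R <= (tup I)%:R `^ w]%classic]%classic.

Definition dec_width (C : btree (constraint V D) -> constraint V D)
    (J : btree (constraint V D)) : \bar R :=
  \big[maxe/-oo%E]_(j <- subtrees J) size_exponent (C j).

(* Only finitely many trees are join decompositions, so these infima are minima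
   as soon as there is at least one constraint; otherwise they are +oo. *)
Definition jw : \bar R :=
  ereal_inf [set dec_width Cpruned J | J in join_decomposition]%classic.

Definition jw_proj : \bar R :=
  ereal_inf [set dec_width Cproj J | J in join_decomposition]%classic.

End Joinwidth.

Arguments jw {V D} I R.
Arguments jw_proj {V D} I R.

(* A hypergraph on the vertex set V is given by its set of edges. *)
Definition hypergraph (V D : finType) (I : csp V D) : {set {set V}} :=
  [set e in [seq vars c | c <- cstrs I]].

Section Covers.
Variables (V : finType) (H : {set {set V}}) (R : realType).

Definition fractional_cover (B : {set V}) (g : {set V} -> R) : Prop :=
  (forall e, e \in H -> 0 <= g e) /\
  (forall v, v \in B -> 1 <= \sum_(e in H | v \in e) g e).

Definition weight (g : {set V} -> R) : R := \sum_(e in H) g e.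

Definition fec : \bar R :=
  ereal_inf [set (weight g)%:E | g in fractional_cover [set: V]]%classic.

Definition is_tree (T : finType) (adj : rel T) : Prop :=
  [/\ (0 < #|T|)%N, symmetric adj, irreflexive adj,
      forall x y, connect adj x y
    & forall p, ucycle adj p -> (size p <= 2)%N].

Definition tree_decomposition (T : finType) (adj : rel T)
    (B : T -> {set V}) : Prop :=
  [/\ is_tree adj,
      forall e, e \in H -> exists t, e \subset B t,
      forall v, exists t, v \in B t
    & forall v t t', v \in B t -> v \in B t' ->
        connect [rel x y | [&& adj x y, v \in B x & v \in B y]] t t'].

Definition fhd (T : finType) (adj : rel T) (B : T -> {set V})
    (g : T -> {set V} -> R) : Prop :=
  tree_decomposition adj B /\ forall t, fractional_cover (B t) (g t).

Definition fhd_width (T : finType) (g : T -> {set V} -> R) : \bar R :=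
  \big[maxe/-oo%E]_(t : T) (weight (g t))%:E.

Definition fhtw : \bar R :=
  ereal_inf [set w | exists (T : finType) (adj : rel T)
    (B : T -> {set V}) (g : T -> {set V} -> R),
    fhd adj B g /\ w = fhd_width g]%classic.

End Covers.

Arguments fec {V} H R.
Arguments fhtw {V} H R.

(* Main.v *)
Require Import Defs.
From mathcomp Require Import all_boot all_order all_algebra finmap.
From mathcomp Require Import all_classical all_reals all_analysis.
From mathcomp Require Import zify.

(** The variables are the subsets S of {0, ..., m-1}, the i-th constraint has as
    scope the sets S containing i, and it allows at most one of them to take a
    nonzero value. Only the sets with at least m/2 elements matter, so weight
    2/m on every edge is a fractional cover of weight 2. Pruning forces the
    nonzero variables to be pairwise disjoint, which leaves at most one inside
    and one outside a given edge: at most N^2 tuples, where N is the number of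
    tuples of a constraint. Without pruning, take a node with a set X of leaves
    such that k <= |X| <= 2k <= m/2. For i in X the variable {i} U (complement
    of X) occurs in the i-th constraint but in no other constraint of X, so
    these |X| variables take arbitrary values independently, which gives at
    least |D|^k tuples, while N <= |D|^2 once |D| >= 2^m; so k >= 2w suffices. *)

Set Implicit Arguments.
Unset Strict Implicit.
Unset Printing Implicit Defensive.

Import Order.TTheory GRing.Theory Num.Theory.

(** * Tuples as restrictions of total assignments *)

Section Assignments.
Variables V D : finType.

Definition val_tuple (s : seq V) (x : V -> D) : (size s).-tuple D :=
  map_tuple x (in_tuple s).

(** The default [d] outside the scope lets tuples over different scopes be compared pointwise. The
    instance below takes its zero value for [d], so nonzero variables lie in the scope. *)
Definition assignment (d : D) (s : seq V) (t : (size s).-tuple D) : V -> D :=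
  fun v => nth d t (index v s).

Definition part (A : {set V}) (x : V -> D) : {ffun V -> option D} :=
  [ffun v => if v \in A then Some (x v) else None].

Definition sat (c : constraint V D) (x : V -> D) : bool :=
  val_tuple (scope c) x \in tuples c.

Lemma restr_val_tuple s x W :
  restr (val_tuple s x) W = part (W :&: [set v in s]) x.
Proof.
apply/ffunP => v; rewrite !ffunE !inE; case: (v \in W) => //=.
case: ifP => vs.
  by rewrite onth_map onthE (nth_map v) ?index_mem //= nth_index.
by rewrite onth_map onth_default //= memNindex ?vs.
Qed.

Lemma val_tuple_eq s x y : {in s, x =1 y} -> val_tuple s x = val_tuple s y.
Proof. by move=> xy; apply/val_inj/eq_in_map. Qed.

Lemma val_tuple_inj s x y : val_tuple s x = val_tuple s y -> {in s, x =1 y}.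
Proof. by move=> /(congr1 val) /= /eq_in_map. Qed.

Lemma assignmentK d s (t : (size s).-tuple D) :
  uniq s -> val_tuple s (assignment d t) = t.
Proof.
move=> us; apply: val_inj => /=; apply: (@eq_from_nth _ d) => [|i].
  by rewrite size_map size_tuple.
rewrite size_map => si; case: s us t si => [//|v s] us t si.
by rewrite (nth_map v) // /assignment index_uniq.
Qed.

Lemma assignment_out d s (t : (size s).-tuple D) v :
  v \notin s -> assignment d t v = d.
Proof.
by move=> vs; rewrite /assignment memNindex // nth_default ?size_tuple.
Qed.

Lemma assignment_val d s x v :
  assignment d (val_tuple s x) v = if v \in s then x v else d.
Proof.
case: ifPn => [vs|]; last exact: assignment_out.
by rewrite /assignment (nth_map v) ?index_mem // nth_index.
Qed.

Lemma sat_project W c x : sat c x -> sat (project W c) x.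
Proof.
move=> cx; rewrite /sat inE; apply/existsP; exists (val_tuple (scope c) x).
rewrite [_ \in _]cx /= !restr_val_tuple; apply/eqP; congr part.
by apply/setP => v; rewrite !inE mem_filter.
Qed.

Lemma sat_join c c' x : sat c x -> sat c' x -> sat (join c c') x.
Proof.
move=> cx cx'; rewrite /sat inE; apply/existsP; exists (val_tuple (scope c) x).
rewrite [_ \in _]cx /=; apply/existsP; exists (val_tuple (scope c') x).
rewrite [_ \in _]cx' /= !restr_val_tuple; apply/andP; split; apply/eqP;
  congr part; apply/setP => v; rewrite !inE mem_cat mem_filter;
  by case: (v \in scope c); case: (v \in scope c').
Qed.

(** All that the upper bound needs from pruning; [d] serves to extend the witness tuple of [c'] to a
    total assignment. *)
Lemma sat_prune (d : D) C c c' x : c' \in C -> sat (prune C c) x ->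
  exists2 y, sat c' y & {in vars c :&: vars c', x =1 y}.
Proof.
move=> c'C; rewrite /sat inE => /andP[_ /allP /(_ _ c'C) /imsetP[t tc']].
rewrite -(assignmentK d t (scope_uniq c')) in tc' * => eq_restr.
exists (assignment d t) => // v vcc'; move: eq_restr; rewrite !restr_val_tuple.
move=> /ffunP /(_ v); move: vcc'; rewrite !ffunE !inE => /andP[-> ->].
by move=> [].
Qed.

Lemma vars_project W (c : constraint V D) : vars (project W c) = vars c :&: W.
Proof. by apply/setP => v; rewrite !inE mem_filter andbC. Qed.

Lemma vars_join (c c' : constraint V D) : vars (join c c') = vars c :|: vars c'.
Proof.
apply/setP => v; rewrite !inE mem_cat mem_filter.
by case: (v \in scope c).
Qed.

End Assignments.

(** * Subtrees of moderate size in binary trees *)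

Section Trees.

(** Descend while some child has at least [k] leaves; where both have fewer, the node itself has at
    most [k.*2]. *)
Lemma subtree_size A k (J : btree A) : 0 < k <= size (leaves J) ->
  exists s1 j s2, subtrees J = s1 ++ j :: s2 /\
    k <= size (leaves j) <= k.*2.
Proof.
move=> /andP[k0]; elim: J => [a|J1 IH1 J2 IH2] kJ.
  exists [::], (Leaf a), [::]; rewrite kJ; split=> //=.
  by rewrite -addnn (leq_trans k0) ?leq_addr.
case: (leqP k (size (leaves J1))) => [/IH1|kJ1].
  move=> [s1 [j [s2 [E jk]]]].
  by exists (Node J1 J2 :: s1), j, (s2 ++ subtrees J2); rewrite /= E -catA.
case: (leqP k (size (leaves J2))) => [/IH2|kJ2].
  move=> [s1 [j [s2 [E jk]]]].
  by exists (Node J1 J2 :: subtrees J1 ++ s1), j, s2; rewrite /= E -catA.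
exists [::], (Node J1 J2), (subtrees J1 ++ subtrees J2); rewrite kJ /=.
by split=> //; rewrite size_cat -addnn leq_add // ltnW.
Qed.

Lemma leaves_subtree (A : eqType) (J j : btree A) s1 s2 :
  subtrees J = s1 ++ j :: s2 -> subseq (leaves j) (leaves J).
Proof.
elim: J s1 s2 => [a|J1 IH1 J2 IH2] [|a1 s1] s2 /=.
- by move=> [<- _] /=; rewrite eqxx.
- by case: s1.
- by move=> [<- _]; exact: subseq_refl.
move=> [_].
case: (leqP (size (subtrees J1)) (size s1)) => [le|lt].
  move=> /(congr1 (drop (size (subtrees J1)))).
  rewrite -[s1](cat_take_drop (size (subtrees J1))) -catA.
  rewrite !drop_size_cat ?size_takel // => E.
  by apply: subseq_trans (suffix_subseq _ _); exact: IH2 E.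
move=> /(congr1 (take (size (subtrees J1)))).
rewrite take_size_cat // take_cat ltnNge ltnW //= -(subnSK lt) /=.
move=> E; apply: subseq_trans (prefix_subseq _ _); exact: IH1 E.
Qed.

(** Caterpillar tree, which turns any ordering of the constraints into a join decomposition. *)
Fixpoint comb A (a : A) (s : seq A) : btree A :=
  if s is b :: s' then Node (Leaf a) (comb b s') else Leaf a.

Lemma leaves_comb A (a : A) s : leaves (comb a s) = a :: s.
Proof. by elim: s a => //= b s IH a; rewrite IH. Qed.

End Trees.

(** * Solutions and variables that survive projection *)

Section Projections.
Variables (V D : finType) (I : csp V D).
Implicit Type j : btree (constraint V D).

(** Source of the lower bound on unpruned sizes: joins and projections never lose a common solution
    of the leaves. *)
Lemma sat_Cproj j x : (forall c, c \in leaves j -> sat c x) -> sat (Cproj I j) x.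
Proof.
elim: j => [c|j1 IH1 j2 IH2] /= jx; apply: sat_project.
  by apply: jx; rewrite inE.
by apply: sat_join; [apply: IH1|apply: IH2] => c cj; apply: jx;
  rewrite mem_cat cj ?orbT.
Qed.

Lemma mem_Vbar j v : reflect
  (exists c, [/\ c \in cstrs I, c \notin leaves j & v \in vars c])
  (v \in Vbar I j).
Proof.
rewrite /Vbar (big_morph (fun A : {set V} => v \in A)
  (fun A B => finset.in_setU v A B) (finset.in_set0 v)) big_has_cond.
apply: (iffP hasP) => [[c cI /andP[cj vc]]|[c [cI cj vc]]]; exists c => //.
by rewrite /= cj.
Qed.

Lemma Vbar_anti j j' : {subset leaves j <= leaves j'} ->
  Vbar I j' \subset Vbar I j.
Proof.
move=> jj'; apply/fintype.subsetP => v /mem_Vbar[c [cI cj vc]]; apply/mem_Vbar.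
by exists c; split=> //; apply: contra cj => /jj'.
Qed.

(** [Vbar] only grows towards the leaves, so a variable of [Vbar I j] is not projected away at any
    node below [j]. *)
Lemma vars_Cproj j c v : v \in Vbar I j -> c \in leaves j -> v \in vars c ->
  v \in vars (Cproj I j).
Proof.
elim: j => [c'|j1 IH1 j2 IH2] /= vj; rewrite vars_project finset.in_setI vj andbT.
  by rewrite inE => /eqP <-.
rewrite mem_cat vars_join finset.in_setU => /orP[] cj vc; apply/orP; [left|right].
  by apply: IH1 => //; apply: (fintype.subsetP (Vbar_anti _)) vj => ? ?;
    rewrite mem_cat; apply/orP; left.
by apply: IH2 => //; apply: (fintype.subsetP (Vbar_anti _)) vj => ? ?;
  rewrite mem_cat; apply/orP; right.
Qed.

End Projections.

Lemma card_set_type (T : finType) : #|{: {set T}}| = 2 ^ #|T|.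
Proof. by rewrite -[LHS]cardsT -powersetT card_powerset cardsT. Qed.

(** * The sparse instance and its tuple counts *)

Section Instance.
Variables (m : nat) (D : finType) (o : D).
Implicit Types (i l : 'I_m) (S : {set 'I_m}) (x : {set 'I_m} -> D).

(* A set with fewer than m/2 elements is put in every edge, so that each
   variable lies in at least half of the edges. *)
Definition edge i : {set {set 'I_m}} :=
  [set S : {set 'I_m} | (#|S|.*2 < m) || (i \in S)].

Definition sparse i : constraint {set 'I_m} D :=
  mk_constraint (enum_uniq (edge i))
    [set t | #|[set S | assignment o t S != o]| <= 1].

Lemma vars_sparse i : vars (sparse i) = edge i.
Proof. by apply/setP => S; rewrite inE mem_enum. Qed.

Lemma sat_sparse i x :
  sat (sparse i) x = (#|[set S in edge i | x S != o]| <= 1).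
Proof.
rewrite /sat inE; congr (_ <= _); apply: eq_card => S.
by rewrite !inE assignment_val mem_enum inE; case: ifP; rewrite ?eqxx.
Qed.

Lemma sat_sparseP i x : reflect
  (forall S S', S \in edge i -> S' \in edge i -> x S != o -> x S' != o -> S = S')
  (sat (sparse i) x).
Proof.
rewrite sat_sparse; apply: (iffP card_le1_eqP) => [E S S' iS iS' xS xS'|E S S'].
  by apply: E; rewrite inE ?iS ?iS'.
by rewrite !inE => /andP[? ?] /andP[? ?]; apply: E; rewrite // inE.
Qed.

(** A small set lies in all [m] edges, a large one in the edge of each of its at least [m/2]
    elements. *)
Lemma edge_majority S : m <= #|[set i | S \in edge i]|.*2.
Proof.
case: (ltnP #|S|.*2 m) => Sm.
  rewrite (_ : [set i | _] = [set: 'I_m]) ?cardsT ?card_ord -?addnn ?leq_addr //.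
  by apply/setP => i; rewrite !inE Sm.
apply: leq_trans Sm _; rewrite leq_double subset_leq_card //.
by apply/fintype.subsetP => i iS; rewrite !inE iS orbT.
Qed.

Definition sparse_constraints : {fset constraint {set 'I_m} D} :=
  [fset sparse i | i in enum 'I_m]%fset.

Lemma sparse_constraintsP c :
  reflect (exists i, c = sparse i) (c \in sparse_constraints).
Proof.
apply: (iffP (imfsetP _ _ _ _)) => [[i _ ->]|[i ->]]; exists i => //.
by rewrite /= mem_enum.
Qed.

(** Both sets have at least [m/2] elements and avoid [i]: too many to be disjoint among [m - 1]
    points. *)
Lemma large_meet S S' i : S \notin edge i -> S' \notin edge i ->
  exists l, S \in edge l /\ S' \in edge l.
Proof.
rewrite !inE !negb_or -!leqNgt => /andP[Sm iS] /andP[Sm' iS'].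
have: 0 < #|S :&: S'|.
  have: #|S :|: S'| <= m.-1.
    rewrite -[m in m.-1]card_ord -(cardsC1 i) subset_leq_card //.
    apply/fintype.subsetP => l; rewrite !inE.
    by apply: contraTneq => ->; rewrite negb_or iS.
  have := cardsUI S S'; have := ltn_ord i; lia.
move=> /card_gt0P[l]; rewrite inE => /andP[lS lS'].
by exists l; rewrite !inE lS lS' !orbT.
Qed.

Lemma card_prune_sparse c i :
  #|tuples (prune sparse_constraints c)| <= #|tuples (sparse i)| ^ 2.
Proof.
pose x t := @assignment _ D o (scope c) t.
(* A set outside the edge has its complement inside it, so the part of an
   assignment outside the edge can be stored as a tuple over the edge. *)
pose inner t := val_tuple (enum (edge i)) (x t).
pose outer t := val_tuple (enum (edge i))
  (fun S => if ~: S \in edge i then o else x t (~: S)).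
(* On edge [l] a surviving tuple agrees with a tuple of [sparse l], which has at most one nonzero
   entry. *)
have amo t l S S' : t \in tuples (prune sparse_constraints c) ->
    S \in edge l -> S' \in edge l -> x t S != o -> x t S' != o -> S = S'.
  move=> tc Sl Sl' xS xS'.
  have vc U : x t U != o -> U \in vars c.
    by apply: contraR; rewrite inE => Uc; exact/eqP/assignment_out.
  have: sat (prune sparse_constraints c) (x t).
    by rewrite /sat assignmentK // scope_uniq.
  have lC : sparse l \in sparse_constraints.
    by apply/sparse_constraintsP; exists l.
  move=> /(sat_prune o lC)[y /sat_sparseP y1 xy].
  by apply: (y1 S S') => //; rewrite -xy // finset.in_setI vc ?vars_sparse.
have inj : {in tuples (prune sparse_constraints c) &,
    injective (fun t => (inner t, outer t))}.
  move=> t t' _ _ eq_tt'.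
  have eqi := val_tuple_inj (congr1 fst eq_tt').
  have eqo := val_tuple_inj (congr1 snd eq_tt').
  rewrite -(assignmentK o t (scope_uniq c)) -(assignmentK o t' (scope_uniq c)).
  apply: val_tuple_eq => S _; case: (boolP (S \in edge i)) => iS.
    by apply: eqi; rewrite mem_enum.
  have: ~: S \in enum (edge i).
    by move: iS; rewrite mem_enum !inE negb_or => /andP[_ ->]; rewrite orbT.
  by move=> /eqo; rewrite finset.setCK (negPf iS).
rewrite -(card_in_imset inj) expnS expn1 -cardsX subset_leq_card //.
apply/fintype.subsetP => _ /imsetP[t tc ->]; rewrite inE /=.
rewrite -![_ \in tuples _]/(sat (sparse i) _).
apply/andP; split; apply/sat_sparseP => S S' iS iS'; first exact: amo tc iS iS'.
(* Nonzero entries of [outer] come from complements outside edge [i]; two such complements share an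
   edge [l], where [amo] makes them equal. *)
case: ifPn => [_|iSC]; rewrite ?eqxx //; case: ifPn => [_|iSC']; rewrite ?eqxx //.
move=> xS xS'; apply: (can_inj (@finset.setCK _)).
by have [l [lS lS']] := large_meet iSC iSC'; exact: amo tc lS lS' xS xS'.
Qed.

(** A tuple is fixed by one variable and its value; the zero tuple is a spike of value [o]. *)
Lemma card_sparse i : #|tuples (sparse i)| <= 2 ^ m * #|D|.
Proof.
pose spike (p : {set 'I_m} * D) :=
  val_tuple (enum (edge i)) (fun S => if S == p.1 then p.2 else o).
have -> : 2 ^ m * #|D| = #|{: {set 'I_m} * D}|.
  by rewrite card_prod card_set_type card_ord.
apply: leq_trans (leq_imset_card spike predT); apply: subset_leq_card.
apply/fintype.subsetP => t ti; apply/imsetP.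
pose x := assignment o t.
have tx : t = val_tuple (enum (edge i)) x by rewrite assignmentK ?enum_uniq.
have: sat (sparse i) x by rewrite /sat /= -tx.
move=> /sat_sparseP x1.
have out S : x S != o -> S \in edge i.
  by rewrite -mem_enum; apply: contraR => Sc; exact/eqP/assignment_out.
case: (pickP (fun S => x S != o)) => [S xS|x0].
  exists (S, x S) => //; rewrite tx; apply: val_tuple_eq => S' _ /=.
  case: eqVneq => [->//|nS]; apply/eqP; apply: contraNT nS => xS'.
  by rewrite (x1 S S') // out.
exists (finset.set0, o) => //; rewrite tx; apply: val_tuple_eq => S' _ /=.
by rewrite if_same; apply/eqP; have /negbFE := x0 S'.
Qed.

Variable m_gt1 : 1 < m.

(** The complement of [l] is not small since [m > 1], so it misses edge [l] and no other. *)
Lemma edge_inj : injective edge.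
Proof.
move=> i l /setP /(_ [set~ l]); rewrite !inE eqxx orbF cardsC1 card_ord.
case: ltnP => [|_]; first by lia.
by case: eqVneq.
Qed.

Lemma sparse_inj : injective sparse.
Proof.
by move=> i l /(congr1 (@vars _ _)); rewrite !vars_sparse => /edge_inj.
Qed.

Lemma sparse_cover S : exists2 c, c \in sparse_constraints & S \in scope c.
Proof.
have: 0 < #|[set i | S \in edge i]| by have := edge_majority S; lia.
move=> /card_gt0P[i]; rewrite inE => iS; exists (sparse i).
  by apply/sparse_constraintsP; exists i.
by rewrite mem_enum.
Qed.

Definition sparse_csp : csp {set 'I_m} D := CSP sparse_cover.

Lemma card_Cproj_sparse j : {subset leaves j <= sparse_constraints} ->
  uniq (leaves j) -> (size (leaves j)).*2 <= m ->
  #|D| ^ size (leaves j) <= #|tuples (Cproj sparse_csp j)|.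
Proof.
move=> jC uj jm; pose X := [set i | sparse i \in leaves j].
have cardX : #|X| = size (leaves j).
  rewrite cardE -(size_map sparse); apply/perm_size/uniq_perm => //.
    by rewrite map_inj_uniq ?enum_uniq //; exact: sparse_inj.
  move=> c; apply/mapP/idP => [[i]|cj]; first by rewrite mem_enum inE => ? ->.
  have /sparse_constraintsP[i ci] := jC _ cj.
  by exists i; rewrite // mem_enum inE -ci.
have cardXC : #|~: X| = m - #|X| by have := cardsC X; rewrite card_ord; lia.
pose mark i := i |: ~: X.
have mark_edge i l : i \in X -> l \in X -> mark i \in edge l = (l == i).
  move=> iX lX.
  (* [mark i] has [m - #|X| + 1] elements, more than half of [m], so the clause for small sets does
     not apply. *)
  have -> : (mark i \in edge l) = (l \in mark i).
    have : #|mark i| = #|~: X|.+1 by rewrite cardsU1 finset.in_setC iX.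
    rewrite inE; case: ltnP => // small cardm; exfalso.
    move: small; rewrite cardm cardXC cardX; lia.
  by rewrite in_setU1 finset.in_setC lX orbF.
have mark_inj i l : i \in X -> l \in X -> mark i = mark l -> i = l.
  move=> iX lX eq_mark; apply/eqP.
  by rewrite -(mark_edge l i) // -eq_mark mark_edge.
pose x (a : {ffun {i | i \in X} -> D}) S :=
  if [pick i : {i | i \in X} | S == mark (sval i)] is Some i then a i else o.
have x_mark a (i : {i | i \in X}) : x a (mark (sval i)) = a i.
  rewrite /x; case: pickP => [l /eqP /mark_inj E|/(_ i)]; last by rewrite eqxx.
  by congr (a _); apply/esym/val_inj/E; exact: valP.
have x_out a S : x a S != o -> exists2 i, i \in X & S = mark i.
  rewrite /x; case: pickP => [i /eqP -> _|_]; last by rewrite eqxx.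
  by exists (sval i) => //; exact: valP.
pose t a := val_tuple (scope (Cproj sparse_csp j)) (x a).
have t_inj : injective t.
  move=> a a' /val_tuple_inj eq_x; apply/ffunP => i.
  rewrite -!x_mark; apply: eq_x.
  have iX : sparse (sval i) \in leaves j by have := valP i; rewrite inE.
  suff: mark (sval i) \in vars (Cproj sparse_csp j) by rewrite inE.
  apply: vars_Cproj iX _; last by rewrite vars_sparse mark_edge //; exact: valP.
  (* Some [l] lies outside [X]; its edge contains every [mark i], which keeps these variables from
     being projected away. *)
  have: 0 < #|~: X| by lia.
  move=> /card_gt0P[l lX]; apply/mem_Vbar; exists (sparse l); split.
  - by apply/sparse_constraintsP; exists l.
  - by move: lX; rewrite !inE.
  - by rewrite vars_sparse inE; apply/orP; right; rewrite inE lX orbT.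
rewrite -cardX -(card_sig (mem X)) -card_ffun -(card_imset _ t_inj).
apply: subset_leq_card; apply/fintype.subsetP => _ /imsetP[a _ ->].
apply: sat_Cproj => c cj; have /sparse_constraintsP[l cl] := jC _ cj.
have lX : l \in X by rewrite inE -cl.
rewrite cl; apply/sat_sparseP => S S' lS lS' /x_out[i iX Si] /x_out[i' iX' Si'].
by move: lS lS'; rewrite Si Si' !mark_edge // => /eqP <- /eqP <-.
Qed.

End Instance.

(** * From tuple counts to width exponents *)

Section Exponents.
Variables (V D : finType) (I : csp V D) (R : realType).

Lemma size_exponent_le (c : constraint V D) n :
  #|tuples c| <= tup I ^ n -> (size_exponent I R c <= n%:R%:E)%E.
Proof.
move=> cn; apply: ge_ereal_inf; exists (n%:R%:E)%E => //; exists n%:R%R => //=.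
by rewrite powR_mulrn // -natrX ler_nat.
Qed.

Lemma size_exponent_ge (c : constraint V D) n : 1 < #|tuples c| ->
  tup I ^ n <= #|tuples c| -> (n%:R%:E <= size_exponent I R c)%E.
Proof.
move=> c1 nc; apply/ereal_infP => _ [e /= ce <-]; rewrite lee_fin.
have: (1 < (tup I)%:R `^ e)%R by apply: lt_le_trans ce; rewrite ltr1n.
(* Powers of base [0] or [1] are at most [1], while the power at hand exceeds [1]. *)
move=> N1; have {N1} : 1 < tup I.
  case: ltngtP N1 => // [|<-]; last by rewrite powR1 ltxx.
  rewrite ltnS leqn0 => /eqP ->; rewrite /powR eqxx.
  by case: (e == 0%R); rewrite ?ltxx // ltNge ler01.
move=> N1; have: ((tup I)%:R `^ n%:R <= (tup I)%:R `^ e :> R)%R.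
  by apply: le_trans ce; rewrite powR_mulrn // -natrX ler_nat.
rewrite /powR pnatr_eq0 -[_ == 0]negbK -lt0n (ltn_trans _ N1) //=.
by rewrite ler_expR ler_pM2r // ln_gt0 // ltr1n.
Qed.

Lemma size_exponent_dec_width (C : btree (constraint V D) -> constraint V D)
    (J j : btree (constraint V D)) s1 s2 : subtrees J = s1 ++ j :: s2 ->
  (size_exponent I R (C j) <= dec_width I R C J)%E.
Proof.
rewrite /dec_width => ->; elim: s1 => [|j' s1 IH] /=;
  by rewrite big_cons le_max ?lexx // IH orbT.
Qed.

Lemma jw_le n : cstrs I != fset0 ->
  (forall c, #|tuples (prune (cstrs I) c)| <= tup I ^ n) ->
  (jw I R <= n%:R%:E)%E.
Proof.
move=> I0 In; apply: ge_ereal_inf.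
have [c [s Es]] : exists c s, cstrs I = c :: s :> seq _.
  case E: (cstrs I : seq _) => [|c s]; last by exists c, s.
  by case/fset0Pn: I0 => c; rewrite -[_ \in _]/(c \in (cstrs I : seq _)) E.
(* The bound holds for every constraint, hence at every node, so any decomposition will do. *)
exists (dec_width I R (Cpruned I) (comb c s)).
  by exists (comb c s); rewrite // /join_decomposition leaves_comb Es.
apply: bigmax_le => [|j _]; first exact: leNye.
exact/size_exponent_le/In.
Qed.

End Exponents.

(** * The uniform cover of weight 2 *)

Section Hypergraph.
Variables (m : nat) (m_gt1 : 1 < m) (D : finType) (o : D) (R : realType).
Let I := sparse_csp o m_gt1.

Lemma hypergraph_sparse : hypergraph I = [set edge i | i in 'I_m].
Proof.
apply/setP => e; rewrite inE; apply/mapP/imsetP => [[c]|[i _ ->]].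
  by move=> /sparse_constraintsP[i ->] ->; exists i; rewrite ?vars_sparse.
exists (sparse o i); last by rewrite vars_sparse.
by apply/sparse_constraintsP; exists i.
Qed.

Lemma uniform_cover B :
  fractional_cover (hypergraph I) B (fun=> 2 / m%:R : R)%R.
Proof.
split=> [e _|S _]; first by rewrite divr_ge0.
rewrite hypergraph_sparse.
rewrite (big_imset_cond _ (fun e : {set _} => S \in e)) /=; last first.
  by move=> i l _ _; exact: edge_inj.
rewrite sumr_const -[X in (_ <= X)%R]mulr_natl mulrA -natrM.
rewrite ler_pdivlMr ?mul1r ?ler_nat ?ltr0n ?(ltn_trans _ m_gt1) //.
by rewrite muln2 (leq_trans (edge_majority S)) // cardsE.
Qed.

Lemma uniform_weight : weight (hypergraph I) (fun=> 2 / m%:R : R)%R = 2%R.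
Proof.
rewrite /weight hypergraph_sparse big_imset => [|? ? _ _]; last exact: edge_inj.
rewrite sumr_const card_ord -[LHS]mulr_natl mulrC divfK //.
by rewrite pnatr_eq0 -lt0n (ltn_trans _ m_gt1).
Qed.

Lemma fec_sparse : (fec (hypergraph I) R <= 2%:E)%E.
Proof.
apply: ge_ereal_inf; exists (2%:E)%E => //.
by exists (fun=> 2 / m%:R)%R; [exact: uniform_cover|rewrite uniform_weight].
Qed.

Lemma fhtw_sparse : (fhtw (hypergraph I) R <= 2%:E)%E.
Proof.
apply: ge_ereal_inf; exists (2%:E)%E => //.
(* A single node whose bag holds all vertices turns the edge cover into a decomposition. *)
exists unit, (fun _ _ => false), (fun=> [set: _]), (fun _ _ => 2 / m%:R)%R.
split; last by rewrite /fhd_width (big_pred1 tt) ?uniform_weight //; case.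
split=> [|t]; last exact: uniform_cover.
split=> [|e _|v|v [] []].
- split=> [|//|//|[] []|p]; rewrite ?card_unit ?connect0 //.
  by case/andP=> _ /card_uniqP <-; rewrite (leq_trans (max_card _)) ?card_unit.
- by exists tt; exact: finset.subsetT.
- by exists tt; rewrite inE.
- by rewrite connect0.
Qed.

End Hypergraph.

(** * Choice of parameters and the gap between the two widths *)

Theorem proposition11 (R : realType) (w : int) :
  exists (V D : finType) (I : csp V D),
    [/\ (jw I R <= 2%:E)%E,
        (fec (hypergraph I) R <= 2%:E)%E,
        (fhtw (hypergraph I) R <= 2%:E)%E
      & ((w%:~R)%:E <= jw_proj I R)%E].
Proof.
(* With [m = 4k], a node with at most [2k] leaves covers at most half of the constraints. The factor
   2 in [k] absorbs the square in [tup_le]. *)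
pose k := (`|w|%N.+1).*2; pose m := k.*2.*2.
have m_gt1 : 1 < m by rewrite /m /k; lia.
(* The domain also consists of the subsets of ['I_m], so that [2 ^ m * #|D|] becomes [#|D| ^ 2]; the
   zero value is an arbitrary choice. *)
pose o : {set 'I_m} := finset.set0.
pose I := sparse_csp o m_gt1.
have tupP (i : 'I_m) : #|tuples (sparse o i)| <= tup I.
  apply: (leq_bigmax_seq (sparse o i)) => //.
  by apply/sparse_constraintsP; exists i.
have tup_le : tup I <= #|{: {set 'I_m}}| ^ 2.
  apply/bigmax_leqP_seq => c /sparse_constraintsP[i ->] _.
  by rewrite (leq_trans (card_sparse _ _)) // card_set_type card_ord.
exists {set 'I_m}, {set 'I_m}, I; split.
- apply: jw_le => [|c].
    apply/fset0Pn; exists (sparse o (Ordinal m_gt1)).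
    by apply/sparse_constraintsP; eexists.
  by rewrite (leq_trans (card_prune_sparse o c (Ordinal m_gt1))) // leq_exp2r.
- exact: fec_sparse.
- exact: fhtw_sparse.
apply/ereal_infP => _ [J JI <-].
have size_J : size (leaves J) = m.
  rewrite (perm_size JI).
  rewrite [LHS](card_imfset _ _ (@sparse_inj _ _ o m_gt1)).
  by rewrite /= undup_id ?enum_uniq ?size_enum_ord.
have [|s1 [j [s2 [Jj /andP[kj jk]]]]] := @subtree_size _ k J.
  by rewrite size_J /m /k; lia.
apply: le_trans (size_exponent_dec_width _ _ _ Jj).
have jJ := leaves_subtree Jj.
have jC : {subset leaves j <= sparse_constraints m o}.
  by move=> c /(mem_subseq jJ); rewrite (perm_mem JI).
have uj : uniq (leaves j) by rewrite (subseq_uniq jJ) // (perm_uniq JI) fset_uniq.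
have : #|{: {set 'I_m}}| ^ k <= #|tuples (Cproj I j)|.
  apply: leq_trans (card_Cproj_sparse _ jC uj _); last by rewrite /m leq_double.
  by rewrite leq_pexp2l // card_set_type expn_gt0.
(* Regroups [#|D| ^ k] as a power of [#|D| ^ 2], which dominates [tup I]. *)
rewrite {1}/k -muln2 mulnC expnM => Cj.
apply: (@le_trans _ _ ((`|w|%N.+1)%:R%:E)%E).
  rewrite lee_fin -[X in (_ <= X)%R]/((Posz `|w|%N.+1)%:~R)%R ler_int; lia.
apply: size_exponent_ge; last first.
  by apply: leq_trans Cj; rewrite leq_exp2r.
apply: leq_trans Cj; rewrite card_set_type card_ord -!expnM -{1}(expn0 2).
by rewrite ltn_exp2l // !muln_gt0 (ltnW m_gt1).
Qed.
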